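(* Let $G$ be a triangle-free graph (finite or countably infinite). Then $G$ embeds into $\mathbb{C}_3$ (i.e., $G$ is isomorphic to an induced subgraph of $\mathbb{C}_3$) if and only if its complement $\overline{G}$ is anti-even-signable.
   Context: The generic circular triangle-free graph $\mathbb{C}_3$ has as vertices the unit complex numbers with rational argument (the range of $\arg$ is $(-\pi,\pi]$), and two distinct vertices $z,w$ are adjacent if and only if $|\arg(z/w)| > \frac{2}{3}\pi$. For a graph $G$, a labelling is a function $\sigma\colon E(G)\to\mathbb{Z}_2$; for a subgraph $H$ put $\sigma(H)=\sum_{e\in E(H)}\sigma(e)$ in $\mathbb{Z}_2$. A labelling $\sigma$ of $G$ is anti-even-balancing if for every induced cycle $C$ of $G$ we have $\sigma(C)=0$ when $C$ has $3$ vertices and $\sigma(C)=1$ otherwise. A graph is anti-even-signable if it admits an anti-even-balancing labelling. *)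

(* Defs.v *)
From HB Require Import structures.
From mathcomp Require Import all_boot all_order all_algebra.
From mathcomp Require Import mathcomp_extra boolp classical_sets functions.
From mathcomp Require Import cardinality fsbigop reals trigo.
From mathcomp.real_closed Require Import complex.

Set Implicit Arguments.
Unset Strict Implicit.
Unset Printing Implicit Defensive.

Import Order.TTheory GRing.Theory Num.Theory.
Local Open Scope classical_set_scope.
Local Open Scope ring_scope.

Record graph := Graph {
  vertex :> Type;
  adj : vertex -> vertex -> Prop;
  adj_sym : forall x y, adj x y -> adj y x;
  adj_irrefl : forall x, ~ adj x x }.

Arguments adj {g}.

Definition triangle_free (G : graph) : Prop :=
  forall x y z : G, ~ [/\ adj x y, adj y z & adj x z].

Section Complement.
Variable G : graph.

Definition compl_adj (x y : G) : Prop := x <> y /\ ~ adj x y.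

Lemma compl_adj_sym x y : compl_adj x y -> compl_adj y x.
Proof. by move=> [nxy nadj]; split=> [/esym//|/adj_sym]. Qed.

Lemma compl_adj_irrefl x : ~ compl_adj x x.
Proof. by case. Qed.

Definition complement : graph := Graph compl_adj_sym compl_adj_irrefl.

End Complement.

Definition is_embedding (G H : graph) (f : G -> H) : Prop :=
  injective f /\ forall x y, adj x y <-> adj (f x) (f y).

Definition embeds (G H : graph) : Prop := exists f : G -> H, is_embedding f.

Section CycleGraph.
Variable n : nat.

(* [i != j] only matters for the degenerate case n = 1. *)
Definition cycle_adj (i j : 'I_n) : Prop :=
  i != j /\ (j = ordS i \/ i = ordS j).

Lemma cycle_adj_sym i j : cycle_adj i j -> cycle_adj j i.
Proof.
by move=> [ij ji]; split; [rewrite eq_sym | case: ji; [right | left]].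
Qed.

Lemma cycle_adj_irrefl i : ~ cycle_adj i i.
Proof. by case; rewrite eqxx. Qed.

Definition cycle_graph : graph := Graph cycle_adj_sym cycle_adj_irrefl.

End CycleGraph.

(* An induced subgraph is given by its vertex set: C is the vertex set of an
   induced cycle on n vertices. *)
Definition induced_cycle (G : graph) (n : nat) (C : set G) : Prop :=
  (3 <= n)%N /\
  exists2 c : cycle_graph n -> G, is_embedding c & C = range c.

Definition edges (G : graph) : set (set G) :=
  [set e | exists x y, adj x y /\ e = [set x; y]].

Arguments edges : clear implicits.

Definition induced_edges (G : graph) (C : set G) : set (edges G) :=
  [set e | val e `<=` C].

Definition labelling (G : graph) : Type := edges G -> 'Z_2.

(* sigma(H) for a subgraph H with finite edge set E; [\sum_(e \in E)] is 0 by
   convention when sigma has infinite support in E. *)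
Definition label_sum (G : graph) (sigma : labelling G) (E : set (edges G)) :
    'Z_2 :=
  \sum_(e \in E) sigma e.

Definition anti_even_balancing (G : graph) (sigma : labelling G) : Prop :=
  forall (n : nat) (C : set G), induced_cycle n C ->
    label_sum sigma (induced_edges C) = if n == 3%N then 0 else 1.

Definition anti_even_signable (G : graph) : Prop :=
  exists sigma : labelling G, anti_even_balancing sigma.

Section GenericCircular.
Variable R : realType.

(* The argument of z != 0 in ]-pi, pi]; see [arg_bounds] and [arg_polar]. *)
Definition arg (z : R[i]) : R :=
  let u := z / `|z| in
  if 0 <= complex.Im u then acos (complex.Re u) else - acos (complex.Re u).

Let unitE (z : R[i]) : z != 0 -> exists a b : R,
  [/\ z / `|z| = Complex a b, a ^+ 2 + b ^+ 2 = 1 & -1 <= a <= 1].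
Proof.
move=> z0; case E : (z / `|z|) => [a b]; exists a, b.
have : `|z / `|z| | = 1 by rewrite normf_div normr_id divff // normr_eq0.
move=> /(congr1 (fun x => x ^+ 2)); rewrite -add_Re2_Im2 E /= expr1n => -[e].
split=> //; rewrite -ler_norml -(@expr_le1 _ 2%N) // real_normK ?num_real //.
by rewrite -e lerDl sqr_ge0.
Qed.

Lemma arg_bounds (z : R[i]) : z != 0 -> - pi < arg z <= pi.
Proof.
move=> /unitE [a [b [E e ab]]]; rewrite /arg E /=.
have pi0 := @pi_gt0 R.
have [b0|b0] := leP 0 b.
  rewrite acos_lepi // andbT; apply: lt_le_trans (acos_ge0 ab).
  by rewrite oppr_lt0.
rewrite ltrN2 acos_ltpi /=; last first.
  move: ab => /andP[a1 ->]; rewrite andbT lt_neqAle a1 andbT; apply/eqP => aN1.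
  move: e; rewrite -aN1 sqrrN expr1n -[RHS]addr0 => /addrI/eqP.
  by rewrite sqrf_eq0 lt_eqF.
by apply: le_trans (ltW pi0); rewrite oppr_le0 acos_ge0.
Qed.

Lemma arg_polar (z : R[i]) :
  z != 0 -> z = `|z| * Complex (cos (arg z)) (sin (arg z)).
Proof.
move=> z0; have [a [b [E e ab]]] := unitE z0.
rewrite -[LHS](divfK (x := `|z|)) ?normr_eq0 // mulrC; congr (_ * _).
rewrite /arg E /=.
have ab' : a \in `[(-1), 1] by rewrite in_itv.
have sb : Num.sqrt (1 - a ^+ 2) = `|b|.
  by rewrite -e addrC addKr sqrtr_sqr.
have [b0|b0] := leP 0 b.
  by rewrite acosK // sin_acos // sb ger0_norm.
by rewrite cosN sinN acosK // sin_acos // sb ltr0_norm // opprK.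
Qed.

Definition C3_vertex : Type :=
  {z : R[i] | `|z| = 1 /\ exists q : rat, arg z = ratr q}.

Definition C3_adj (z w : C3_vertex) : Prop :=
  z <> w /\ `|arg (sval z / sval w)| > 2%:R / 3%:R * pi.

Let norm_arg_inv (z : R[i]) : z != 0 -> `|arg z^-1| = `|arg z|.
Proof.
suff H (u : R[i]) : u != 0 -> `|arg u| = acos (complex.Re (u / `|u|)).
  move=> z0; rewrite !H ?invr_eq0 //; congr acos.
  have n0 : `|z| != 0 by rewrite normr_eq0.
  rewrite normfV invrK invc_norm.
  have -> : `|z| ^- 2 * z^*%C * `|z| = (z / `|z|)^*%C.
    have nJ : `|z|^*%C = `|z| by rewrite normc_def conjc_real.
    have -> : (z / `|z|)^*%C = z^*%C / `|z|.
      by rewrite rmorphM -{2}nJ -conjc_inv.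
    rewrite expr2 invfM.
    by rewrite mulrAC -[_ * _ * `|z|]mulrA mulVf // mulr1 mulrC.
  by case: (z / `|z|).
move=> /unitE [a [b [E e ab]]]; rewrite /arg E /=.
by case: ifP => _; rewrite ?normrN ger0_norm ?acos_ge0.
Qed.

Lemma C3_adj_sym z w : C3_adj z w -> C3_adj w z.
Proof.
case: z w => [z [z1 zq]] [w [w1 wq]] [zw /= h]; split; first by move/esym.
rewrite /= -(invf_div z w) norm_arg_inv // mulf_neq0 ?invr_eq0 //.
  by rewrite -normr_eq0 z1 oner_eq0.
by rewrite -normr_eq0 w1 oner_eq0.
Qed.

Lemma C3_adj_irrefl z : ~ C3_adj z z.
Proof. by case. Qed.

(* The argument of a vertex is a rational number (not a rational multiple of
   pi), so |arg (z / w)| never equals 2 pi / 3 on vertices. *)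
Definition C3 : graph := Graph C3_adj_sym C3_adj_irrefl.

End GenericCircular.

(* Main.v *)
Require Import Defs.
From mathcomp Require Import all_boot all_order all_algebra.
From mathcomp Require Import all_classical reals.
From mathcomp Require Import trigo pi_irrational lra zify.
From mathcomp.real_closed Require Import complex.
Local Open Scope classical_set_scope.

(* Fold the circle onto an arc of length 2 pi / 3, recording the lost third as a
   colour in Z/3: a graph embeds into C_3 as soon as its vertices carry a linear
   order and a 3-colouring c such that x < y are adjacent iff c y = c x + 1.
   Given the colouring, the order between two colours is forced by adjacency,
   and it is acyclic iff G is triangle-free, no independent triple has all three
   colours, and no two colour classes induce a 2K_2.

   To find such a colouring from a labelling s of the complement, fix an edge
   v0 a0 and colour the neighbours A of v0 with 1. A non-neighbour u of v0 lies
   on the side s(v0 u) + s(u a) + s(a a0) of v0, for any a in A not adjacent to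
   u; the conditions on cycles of length 3, 4 and 5 of the complement make this
   consistent.

   Conversely, label a non-adjacent pair of points of C_3 by 1 iff the short arc
   between them crosses the point -1. An induced cycle of length 4 or 5 of the
   complement always turns in the same direction and winds once around the
   circle, while a triangle does not wind since 2 pi / 3 is irrational; longer
   induced cycles would give a triangle in G. *)

Set Implicit Arguments.
Unset Strict Implicit.
Unset Printing Implicit Defensive.

Import Order.TTheory GRing.Theory Num.Theory.

(** * Labellings of the complement *)

(* The value of s on adjacent pairs is irrelevant. *)
Definition signing (G : graph) (s : G -> G -> bool) : Prop :=
  [/\ forall x y, s x y = s y x,
      forall x y z, ~ adj x y -> ~ adj y z -> ~ adj z x ->
        s x y (+) s y z (+) s z x = false,
      forall x y z w, ~ adj x y -> ~ adj y z -> ~ adj z w -> ~ adj w x ->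
        adj x z -> adj y w ->
        s x y (+) s y z (+) s z w (+) s w x = true &
      forall x y z w t, ~ adj x y -> ~ adj y z -> ~ adj z w -> ~ adj w t ->
        ~ adj t x -> adj x z -> adj y w -> adj z t -> adj w x -> adj t y ->
        s x y (+) s y z (+) s z w (+) s w t (+) s t x = true].

Section Labels.
Variables (G : graph) (sigma : labelling G).

(** Makes the labelling a total function of two vertices, so that sums along a cycle carry no proofs
    of edgehood. *)
Definition pair_label (x y : G) : 'Z_2 :=
  if pselect (edges G [set x; y]) is left xy then
    sigma (SigSub (mem_set xy)) else 0%R.

Lemma pair_labelC x y : pair_label x y = pair_label y x.
Proof. by rewrite /pair_label setUC. Qed.

Lemma ordS_val n (i : 'I_n) :
  ordS i = (if (i.+1 == n)%N then 0 else i.+1)%N :> nat.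
Proof.
rewrite /=; case: eqP => [->|ni]; first exact: modnn.
by rewrite modn_small // ltn_neqAle ltn_ord andbT; apply/eqP.
Qed.

Lemma ordS_neq n (i : 'I_n) : (1 < n)%N -> ordS i != i.
Proof.
move=> n1; apply/eqP => /(congr1 (@nat_of_ord n)); rewrite ordS_val.
by case: eqP; lia.
Qed.

Lemma ordS2_neq n (i : 'I_n) : (2 < n)%N -> ordS (ordS i) != i.
Proof.
move=> n2; apply/eqP => /(congr1 (@nat_of_ord n)); rewrite !ordS_val.
by do 2 case: eqP; lia.
Qed.

Lemma pair_set_inj (T : Type) (x y x' y' : T) : [set x; y] = [set x'; y'] ->
  x = x' /\ y = y' \/ x = y' /\ y = x'.
Proof.
move=> e.
have [ex|ex] : [set x'; y'] x by rewrite -e; left.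
  have [ey|ey] : [set x'; y'] y by rewrite -e; right.
    have [|] : [set x; y] y' by rewrite e; right.
      by left; split; congruence.
    by left; split; congruence.
  by left.
have [ey|ey] : [set x'; y'] y by rewrite -e; right.
  by right.
have [|] : [set x; y] x' by rewrite e; left.
  by left; split; congruence.
by right; split; congruence.
Qed.

(** The map sending i to the pair [c i], [c (ordS i)] is a bijection from the indices onto the edges
    inside the cycle: onto because the cycle is induced, injective because its length is at least
    3. *)
Lemma label_sum_cycle n (c : cycle_graph n -> G) : (3 <= n)%N ->
  is_embedding c ->
  label_sum sigma (induced_edges (range c)) =
    (\sum_(i < n) pair_label (c i) (c (ordS i)))%R.
Proof.
move=> n3 [c_inj cE].
have n1 : (1 < n)%N by apply: ltn_trans n3.
have cadj i : adj (c i) (c (ordS i)).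
  by apply/cE; split; [rewrite eq_sym ordS_neq | left].
have cedge i : edges G [set c i; c (ordS i)] by exists (c i), (c (ordS i)).
pose h i : edges G := SigSub (mem_set (cedge i)).
rewrite /label_sum (reindex_fsbig h [set: 'I_n]); last first.
  split.
  - by move=> i _ z /= [->|->]; [exists i|exists (ordS i)].
  - move=> i j _ _ hij.
    have eij : [set c i; c (ordS i)] = [set c j; c (ordS j)].
      exact: (congr1 (fun e : edges G => val e) hij).
    (* Matching the endpoints crosswise would give j = j + 2 modulo n. *)
    have [[ij _]|[ij ji]] := pair_set_inj eij; first exact: c_inj.
    by move: (ordS2_neq j n3); rewrite -(c_inj _ _ ij) (c_inj _ _ ji) eqxx.
  - move=> [e eP] /= sub.
    have [x [y [xy exy]]] := set_mem eP.
    have [i _ ci] : range c x by apply: sub; rewrite /= exy; left.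
    have [j _ cj] : range c y by apply: sub; rewrite /= exy; right.
    move: xy; rewrite -ci -cj => /cE [_ [ij|ji]].
      by exists i => //; apply: val_inj; rewrite /= exy -ci -cj ij.
    by exists j => //; apply: val_inj; rewrite /= exy -ci -cj ji setUC.
transitivity (\sum_(i \in [set: 'I_n]) pair_label (c i) (c (ordS i)))%R.
  apply: eq_fsbigr => i _; rewrite /pair_label.
  case: pselect => // e; congr sigma; exact: val_inj.
rewrite [RHS]fsbig_seq ?index_enum_uniq //.
suff -> : [set` index_enum 'I_n] = [set: 'I_n] by [].
by apply/seteqP; split=> // i _ /=; rewrite mem_index_enum.
Qed.

End Labels.

Lemma Z2_eq1D (a b : 'Z_2) : (a + b == 1 = (a == 1) (+) (b == 1))%R.
Proof. by case: a b => [[|[|]] ?] // [[|[|]] ?]. Qed.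

Lemma compl_cycle_embedding (G : graph) n (c : 'I_n -> G) :
  injective c -> (forall i, ~ adj (c i) (c (ordS i))) ->
  (forall i j, i != j -> j != ordS i -> i != ordS j -> adj (c i) (c j)) ->
  @is_embedding (cycle_graph n) (complement G) c.
Proof.
move=> c_inj nadjS adj_far; split=> // i j; split.
  move=> [ij ijS]; split; first by move/c_inj/eqP; apply/negP.
  by case: ijS => ->; [|move/adj_sym]; apply: nadjS.
move=> [cij nij]; have ij : i != j by apply: contra_notN cij => /eqP ->.
split=> //; apply: contrapT => /not_orP[/eqP ji /eqP ij'].
by apply: nij; apply: adj_far.
Qed.

Ltac adj_contradiction := exfalso;
  match goal with
  | H : adj ?x ?x |- _ => exact: adj_irrefl H
  | H : adj ?x ?y, H' : ~ adj ?x ?y |- _ => exact: H' H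
  | H : adj ?x ?y, H' : ~ adj ?y ?x |- _ => exact: H' (adj_sym H)
  end.

Lemma signable_signing (G : graph) : anti_even_signable (complement G) ->
  exists s : G -> G -> bool, signing s.
Proof.
move=> [sigma sigmaP].
pose s (x y : G) := pair_label sigma x y == 1%R.
have label_cycle n (c : 'I_n -> G) : (3 <= n)%N ->
    @is_embedding (cycle_graph n) (complement G) c ->
    (\sum_(i < n) pair_label sigma (c i) (c (ordS i)) =
     if n == 3%N then 0 else 1)%R.
  move=> n3 cP; rewrite -label_sum_cycle //; apply: sigmaP; split=> //.
  by exists c.
have sxx (x : G) : s x x = false.
  rewrite /s /pair_label; case: pselect => // xx; exfalso.
  have [y [z [[yz _] e]]] := xx.
  by have [] := pair_set_inj e => -[xy xz]; case: yz; congruence.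
exists s; split.
- by move=> x y; rewrite /s pair_labelC.
- move=> x y z xy yz zx.
  (* The triangle condition of [signing] also covers coinciding vertices; there it follows from
     symmetry and [sxx]. *)
  have [->|nxy] := pselect (x = y).
    by rewrite sxx /s (pair_labelC sigma z) addbb.
  have [->|nyz] := pselect (y = z).
    by rewrite sxx /s (pair_labelC sigma z) addbF addbb.
  have [->|nzx] := pselect (z = x).
    by rewrite sxx /s (pair_labelC sigma y) addbF addbb.
  have := @label_cycle 3%N (nth x [:: x; y; z]) isT.
  rewrite !big_ord_recl big_ord0 addr0 /= => /(_ _)/(congr1 (eq_op^~ 1%R)).
  rewrite !Z2_eq1D addbA; apply; apply: compl_cycle_embedding.
  + case=> [[|[|[|i]]] hi] [[|[|[|j]]] hj] //= e;
      first [exact: val_inj | congruence].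
  + by case=> [[|[|[|i]]] hi].
  + by case=> [[|[|[|i]]] hi] [[|[|[|j]]] hj].
- move=> x y z w xy yz zw wx xz yw.
  have := @label_cycle 4%N (nth x [:: x; y; z; w]) isT.
  rewrite !big_ord_recl big_ord0 addr0 /= => /(_ _)/(congr1 (eq_op^~ 1%R)).
  rewrite !Z2_eq1D !addbA; apply; apply: compl_cycle_embedding.
  (* Distinctness is automatic: two equal vertices would be adjacent to themselves or have
     contradictory adjacencies. *)
  + case=> [[|[|[|[|i]]]] hi] [[|[|[|[|j]]]] hj] //= e;
      first [exact: val_inj | by subst; adj_contradiction].
  + by case=> [[|[|[|[|i]]]] hi].
  + by case=> [[|[|[|[|i]]]] hi] [[|[|[|[|j]]]] hj] // _ _ _ /=; apply: adj_sym.
- move=> x y z w t xy yz zw wt tx xz yw zt wx ty.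
  have := @label_cycle 5%N (nth x [:: x; y; z; w; t]) isT.
  rewrite !big_ord_recl big_ord0 addr0 /= => /(_ _)/(congr1 (eq_op^~ 1%R)).
  rewrite !Z2_eq1D !addbA; apply; apply: compl_cycle_embedding.
  + case=> [[|[|[|[|[|i]]]]] hi] [[|[|[|[|[|j]]]]] hj] //= e;
      first [exact: val_inj | by subst; adj_contradiction].
  + by case=> [[|[|[|[|[|i]]]]] hi].
  + by case=> [[|[|[|[|[|i]]]]] hi] [[|[|[|[|[|j]]]]] hj] // _ _ _ /=;
      apply: adj_sym.
Qed.

(** The vertices 0, 2, 4 work, 4 and 0 not being consecutive once n is at least 6. For an induced
    cycle of the complement they would form a triangle of G. *)
Lemma cycle_ge6_independent n : (6 <= n)%N ->
  exists i j k : cycle_graph n,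
    [/\ i <> j, j <> k, i <> k & [/\ ~ adj i j, ~ adj j k & ~ adj i k]].
Proof.
move=> n6.
have lt0 : (0 < n)%N by lia.
have lt2 : (2 < n)%N by lia.
have lt4 : (4 < n)%N by lia.
exists (Ordinal lt0), (Ordinal lt2), (Ordinal lt4).
have far (i j : 'I_n) : (i.+1 < j)%N -> (j.+1 < i + n)%N -> ~ cycle_adj i j.
  move=> ij ji [_ [/(congr1 (@nat_of_ord n))|/(congr1 (@nat_of_ord n))]];
    rewrite ordS_val; case: eqP; lia.
by split; [by []..|split; apply: far => /=; lia].
Qed.

Lemma signing_signable (G : graph) (s : G -> G -> bool) :
  triangle_free G -> signing s -> anti_even_signable (complement G).
Proof.
move=> tfG [sC tri quad pent].
(* An edge is an unordered pair, so its label is read through some ordering of it; by symmetry of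
   [s] any ordering gives the same label. *)
pose sigma : labelling (complement G) := fun e =>
  ((`[< exists x y, val e = [set x; y] /\ s x y >] : nat)%:R)%R.
have labelE (x y : G) : @adj (complement G) x y ->
    pair_label sigma x y = ((s x y : nat)%:R)%R.
  move=> xy; rewrite /pair_label; case: pselect => [e|[]]; last by exists x, y.
  rewrite /sigma /=; congr (_%:R)%R; congr nat_of_bool.
  apply/asboolP/idP => [[x' [y' [e' sxy]]]|sxy]; last by exists x, y.
  by have [] := pair_set_inj e' => -[-> ->]; rewrite // sC.
have Z2_of_bool (b : bool) : ((b : nat)%:R == 1 :> 'Z_2)%R = b by case: b.
exists sigma => n C [n3 [c cP ->]]; rewrite label_sum_cycle //.
have [c_inj cE] := cP.
have cS i : @adj (complement G) (c i) (c (ordS i)).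
  by apply/cE; split; [rewrite eq_sym ordS_neq // ltnW | left].
under eq_bigr => i _ do rewrite labelE //.
have nadjS i : ~ adj (c i : G) (c (ordS i)) by case: (cS i).
have adj_far (i j : 'I_n) : i != j -> j != ordS i -> i != ordS j ->
    adj (c i : G) (c j).
  move=> ij ji ij'; apply: contrapT => nij.
  have /cE[_ []/eqP] : @adj (complement G) (c i) (c j).
    by split=> //; move/c_inj/eqP; apply/negP.
  - exact/negP.
  - exact/negP.
have [n6|n6] := leqP 6 n.
  have [i [j [k [ij jk ik [nij njk nik]]]]] := cycle_ge6_independent n6.
  have far (i' j' : cycle_graph n) : i' <> j' -> ~ adj i' j' ->
      adj (c i' : G) (c j').
    move=> nij' nadjij; apply: contrapT => h; apply: nadjij; apply/cE.
    by split=> // /c_inj.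
  by case: (tfG (c i) (c j) (c k)); split; apply: far.
have Z2_inj (a b : 'Z_2) : (a == 1)%R = (b == 1)%R -> a = b.
  by case: a b => [[|[|]] ?] // [[|[|]] ?] //= _; apply: val_inj.
apply: Z2_inj.
case: n => [|[|[|[|[|[|n]]]]]] // in c n3 c_inj cE cP cS nadjS adj_far n6 *.
(* The indices produced by unrolling the sum become iterates of [ordS], the form in which the facts
   on consecutive vertices apply. *)
- have e1 : lift ord0 ord0 = ordS ord0 :> 'I_3 by apply: val_inj.
  have e2 : lift ord0 (lift ord0 ord0) = ordS (ordS ord0) :> 'I_3.
    exact: val_inj.
  have e3 : ordS (ordS (ordS ord0)) = ord0 :> 'I_3 by apply: val_inj.
  rewrite !big_ord_recl big_ord0 addr0 e2 e1 e3 !Z2_eq1D !Z2_of_bool addbA.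
  by apply: tri => //; rewrite -{2}e3.
- have e1 : lift ord0 ord0 = ordS ord0 :> 'I_4 by apply: val_inj.
  have e2 : lift ord0 (lift ord0 ord0) = ordS (ordS ord0) :> 'I_4.
    exact: val_inj.
  have e3 : lift ord0 (lift ord0 (lift ord0 ord0)) =
      ordS (ordS (ordS ord0)) :> 'I_4 by apply: val_inj.
  have e4 : ordS (ordS (ordS (ordS ord0))) = ord0 :> 'I_4 by apply: val_inj.
  rewrite !big_ord_recl big_ord0 addr0 e3 e2 e1 e4 !Z2_eq1D !Z2_of_bool !addbA.
  apply: quad => //; do ?by apply: adj_far.
  by rewrite -{2}e4.
- have e1 : lift ord0 ord0 = ordS ord0 :> 'I_5 by apply: val_inj.
  have e2 : lift ord0 (lift ord0 ord0) = ordS (ordS ord0) :> 'I_5.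
    exact: val_inj.
  have e3 : lift ord0 (lift ord0 (lift ord0 ord0)) =
      ordS (ordS (ordS ord0)) :> 'I_5 by apply: val_inj.
  have e4 : lift ord0 (lift ord0 (lift ord0 (lift ord0 ord0))) =
      ordS (ordS (ordS (ordS ord0))) :> 'I_5 by apply: val_inj.
  have e5 : ordS (ordS (ordS (ordS (ordS ord0)))) = ord0 :> 'I_5.
    exact: val_inj.
  rewrite !big_ord_recl big_ord0 addr0 e4 e3 e2 e1 e5 !Z2_eq1D !Z2_of_bool.
  rewrite !addbA; apply: pent => //; do ?by apply: adj_far.
  by rewrite -{2}e5.
Qed.

(** * From labellings to colourings *)

Lemma adjC (G : graph) (x y : G) : adj x y <-> adj y x.
Proof. by split; apply: adj_sym. Qed.

Lemma nadjC (G : graph) (x y : G) : ~ adj x y -> ~ adj y x.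
Proof. by move=> xy /adj_sym. Qed.

(** Any triple with all three colours can be listed in cyclic colour order. In the last clause x, y
    and a, b are non-adjacent by properness, so that clause forbids an induced 2K_2. *)
Definition circular_coloring (G : graph) (c : G -> 'I_3) : Prop :=
  [/\ forall x y, adj x y -> c x <> c y,
      forall x y z, c y = ordS (c x) -> c z = ordS (c y) ->
        ~ [/\ ~ adj x y, ~ adj y z & ~ adj z x] &
      forall x y a b, c x = c y -> c a = c b ->
        adj x a -> adj y b -> ~ adj x b -> ~ adj y a -> False].

Ltac case_all1 f :=
  repeat match goal with |- context [f ?x] => case: (f x) end.
Ltac case_all2 f :=
  repeat match goal with |- context [f ?x ?y] => case: (f x y) end.

Section Coloring.
Variables (G : graph) (s : G -> G -> bool).
Hypotheses (tfG : triangle_free G) (sP : signing s).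
Variables v0 a0 : G.
Hypothesis v0a0 : adj v0 a0.

Let sC x y : s x y = s y x. Proof. by case: sP. Qed.

Let tri x y z : ~ adj x y -> ~ adj y z -> ~ adj x z ->
  s x z = s x y (+) s y z.
Proof.
case: sP => _ t _ _ xy yz xz; move: (t x y z xy yz).
by rewrite (adjC z) (sC z) => /(_ xz); case_all2 s.
Qed.

Let no_tri (x y z : G) : adj x y -> adj x z -> ~ adj y z.
Proof. by move=> xy xz yz; apply: (tfG (And3 xy yz xz)). Qed.

Let phi u a := s v0 u (+) s u a (+) s a a0.

(** The second clause serves a vertex u adjacent to all neighbours of [v0], where no a is available:
    u goes opposite to its neighbours w. There [a0] can be used for w, since u, w, [a0] is not a
    triangle. *)
Let side_spec u b :=
  (forall a, adj v0 a -> ~ adj u a -> b = phi u a) /\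
  (forall w, (forall a, adj v0 a -> adj u a) -> adj u w -> ~ adj v0 w ->
     b = ~~ phi w a0).

(** Neighbours of a common vertex are pairwise non-adjacent, so two choices of a, or of w, are
    compared by triangle conditions. *)
Let side_exists u : exists b, side_spec u b.
Proof.
have [[a [v0a ua]]|all_u] := pselect (exists a, adj v0 a /\ ~ adj u a).
  exists (phi u a); split=> [a' v0a' ua'|w]; last by move=> /(_ _ v0a).
  have aa' := no_tri v0a v0a'.
  rewrite /phi (tri ua aa' ua') (tri aa' (no_tri v0a' v0a0) (no_tri v0a v0a0)).
  by rewrite sC; case_all2 s.
have {}all_u a : adj v0 a -> adj u a.
  by move=> v0a; apply: contrapT => ua; apply: all_u; exists a.
have ua0 := all_u _ v0a0.
have [[w [uw v0w]]|no_w] := pselect (exists w, adj u w /\ ~ adj v0 w).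
  exists (~~ phi w a0); split=> [a /all_u//|w' _ uw' v0w']; congr negb.
  have ww' := no_tri uw uw'.
  rewrite /phi (tri v0w ww' v0w') (tri ww' (no_tri uw' ua0) (no_tri uw ua0)).
  by case_all2 s.
(* All neighbours of u are neighbours of [v0] here, so either side will do. *)
by exists false; split=> [a /all_u//|w _ uw v0w]; case: no_w; exists w.
Qed.

Let side u : bool := sval (cid (side_exists u)).

Let sideE (u a : G) : adj v0 a -> ~ adj u a -> side u = phi u a.
Proof.
by move=> v0a ua; rewrite /side; case: cid => b [bE _] /=; apply: bE.
Qed.

Let sideE_dominating (u w : G) : (forall a, adj v0 a -> adj u a) ->
  adj u w -> ~ adj v0 w -> side u = ~~ phi w a0.
Proof.
by move=> uA uw v0w; rewrite /side; case: cid => b [_ bE] /=; apply: bE.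
Qed.

(** If a neighbour a of [v0] is adjacent to neither u nor w, then v0, u, a, w is an induced 4-cycle
    of the complement. Otherwise a misses u, b misses w, and v0, u, a, b, w is an induced 5-cycle.
    In both cases the odd label sum separates the sides. *)
Let side_adj (u w : G) :
  ~ adj v0 u -> ~ adj v0 w -> adj u w -> side u <> side w.
Proof.
move=> v0u v0w uw.
have [uA|] := pselect (forall a, adj v0 a -> adj u a).
  rewrite (sideE_dominating uA uw v0w) (@sideE w a0) //; first by case: phi.
  exact: no_tri uw (uA _ v0a0).
have [wA|] := pselect (forall a, adj v0 a -> adj w a).
  rewrite (sideE_dominating wA (adj_sym uw) v0u) (@sideE u a0) //.
    by case: phi.
  exact: no_tri (adj_sym uw) (wA _ v0a0).
move=> /existsNP[b /not_implyP[v0b wb]] /existsNP[a /not_implyP[v0a ua]].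
have [_ _ quad pent] := sP.
have [common|no_common] :=
  pselect (exists a, [/\ adj v0 a, ~ adj u a & ~ adj w a]).
  case: common => {a v0a ua} a [v0a ua wa].
  rewrite (sideE v0a ua) (sideE v0a wa) /phi.
  have := quad v0 u a w v0u ua (nadjC wa) (nadjC v0w) v0a uw.
  by rewrite (sC w) (sC a w); case_all2 s.
have wa : adj w a.
  by apply: contrapT => wa; apply: no_common; exists a.
have ub : adj u b.
  by apply: contrapT => ub; apply: no_common; exists b.
have ab := no_tri v0a v0b.
have := pent v0 u a b w v0u ua ab (nadjC wb) (nadjC v0w) v0a ub (adj_sym wa)
  (adj_sym v0b) (adj_sym uw).
rewrite (sideE v0a ua) (sideE v0b wb) /phi.
rewrite (tri ab (no_tri v0b v0a0) (no_tri v0a v0a0)) (sC w v0) (sC b w).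
by case_all2 s.
Qed.

(** Add the triangle conditions for v0, x, y and x, y, a: the label of xy cancels. This excludes
    independent triples with all three colours. *)
Let side_independent (a x y : G) : adj v0 a -> ~ adj v0 x -> ~ adj v0 y ->
  ~ adj x y -> ~ adj x a -> ~ adj y a -> side x = side y.
Proof.
move=> v0a v0x v0y xy xa ya.
rewrite (sideE v0a xa) (sideE v0a ya) /phi (tri v0x xy v0y) (tri xy ya xa).
by case_all2 s.
Qed.

(** The 2K_2 of G is the induced 4-cycle x, y, a, b of the complement, whose label sum is odd. *)
Let side_2K2 (x y a b : G) : adj v0 a -> adj v0 b -> ~ adj v0 x -> ~ adj v0 y ->
  adj x a -> adj y b -> ~ adj x b -> ~ adj y a -> ~ adj x y -> side x <> side y.
Proof.
move=> v0a v0b v0x v0y xa yb xb ya xy.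
have ab := no_tri v0a v0b.
rewrite (sideE v0b xb) (sideE v0a ya) /phi (tri v0x xy v0y).
rewrite (tri ab (no_tri v0b v0a0) (no_tri v0a v0a0)).
have [_ _ quad _] := sP; have := quad x y a b xy ya ab.
by rewrite (adjC b) => /(_ xb xa yb); rewrite (sC b); case_all2 s.
Qed.

(** Coning the 4-cycle x, y, a, b of the complement from [v0] cuts it into four triangles with even
    sums, against its odd sum. *)
Let no_2K2_far (x y a b : G) :
  ~ adj v0 x -> ~ adj v0 y -> ~ adj v0 a -> ~ adj v0 b ->
  adj x a -> adj y b -> ~ adj x b -> ~ adj y a -> ~ adj x y -> ~ adj a b ->
  False.
Proof.
move=> v0x v0y v0a v0b xa yb xb ya xy ab.
have [_ _ quad _] := sP; have := quad x y a b xy ya ab.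
rewrite (adjC b) => /(_ xb xa yb).
have := (tri v0x xy v0y, tri v0y ya v0a, tri v0a ab v0b, tri v0x xb v0b).
by rewrite (sC b x); case_all2 s => //=; case=> [[[]]].
Qed.

Let col u : 'I_3 :=
  inord (if `[< adj v0 u >] then 1 else if side u then 2 else 0).

Let colE u : adj v0 u /\ col u = 1%N :> nat \/
  ~ adj v0 u /\ col u = (if side u then 2 else 0)%N :> nat.
Proof.
rewrite /col; case: asboolP => v0u; [left|right]; rewrite inordK //.
by case: side.
Qed.

Lemma circular_coloring_from_edge : exists c : G -> 'I_3, circular_coloring c.
Proof.
have col_proper x y : adj x y -> col x <> col y.
  move=> xy /(congr1 val) /=.
  case: (colE x) => -[v0x ->]; case: (colE y) => -[v0y ->].
  - by case: (no_tri v0x v0y).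
  - by case: side.
  - by case: side.
  - by have := side_adj v0x v0y xy; case_all1 side.
exists col; split=> //.
(* Exactly one of the three is a neighbour of [v0]; the other two would have to lie on different
   sides. *)
- move=> x y z /(congr1 val) /= + /(congr1 val) /= + [xy yz zx].
  have yx := nadjC xy; have zy := nadjC yz; have xz := nadjC zx.
  case: (colE x) => -[v0x ->]; case: (colE y) => -[v0y ->];
    case: (colE z) => -[v0z ->].
  - by [].
  - by case: side.
  - by case: side.
  - by have := side_independent v0x v0y v0z yz yx zx; case_all1 side.
  - by case_all1 side.
  - by have := side_independent v0y v0x v0z xz xy zy; case_all1 side.
  - by have := side_independent v0z v0x v0y xy xz yz; case_all1 side.
  - by case_all1 side.
- move=> x y a b xy ab xa yb xb ya.
  have nxy : ~ adj x y by move/col_proper.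
  have nab : ~ adj a b by move/col_proper.
  move: (xy) (ab) => /(congr1 val) /= + /(congr1 val) /=.
  have yx := nadjC nxy; have ba := nadjC nab.
  have bx := nadjC xb; have ay := nadjC ya.
  have ax := adj_sym xa; have by_ := adj_sym yb.
  (* Equal colours put x and y both inside or both outside the neighbourhood of [v0], and likewise a
     and b: four cases survive. *)
  case: (colE x) => -[v0x ->]; case: (colE y) => -[v0y ->];
    case: (colE a) => -[v0a ->]; case: (colE b) => -[v0b ->];
    try by (case_all1 side).
  - by case: (no_tri v0x v0a).
  - have := side_2K2 v0x v0y v0a v0b ax by_ ay bx nab.
    by case_all1 side.
  - have := side_2K2 v0a v0b v0x v0y xa yb xb ya nxy.
    by case_all1 side.
  - by case: (no_2K2_far v0x v0y v0a v0b xa yb xb ya nxy nab).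
Qed.

End Coloring.

Lemma signing_circular_coloring (G : graph) (s : G -> G -> bool) :
  triangle_free G -> signing s -> exists c : G -> 'I_3, circular_coloring c.
Proof.
move=> tfG sP.
have [[v0 [a0 v0a0]]|noE] := pselect (exists v a : G, adj v a).
  exact: (circular_coloring_from_edge tfG sP v0a0).
exists (fun=> ord0); split=> [x y xy|x y z /(congr1 val)|x y a b _ _ xa] //.
- by case: noE; exists x, y.
- by case: noE; exists x, a.
Qed.

(** * From colourings to linear orders *)

Definition strict_total (T : Type) (lt : T -> T -> Prop) : Prop :=
  [/\ forall x, ~ lt x x, forall x y z, lt x y -> lt y z -> lt x z &
      forall x y, x <> y -> lt x y \/ lt y x].

Lemma ord3_cases (i j : 'I_3) : [\/ i = j, j = ordS i | i = ordS j].
Proof.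
case: i j => [[|[|[|i]]] hi] [[|[|[|j]]] hj] //;
  do [by apply: Or31; apply: val_inj | by apply: Or32; apply: val_inj
     | by apply: Or33; apply: val_inj].
Qed.

Lemma ordS3_neq (i : 'I_3) : ordS i <> i.
Proof. by case: i => [[|[|[|i]]] hi] // /(congr1 val). Qed.

Lemma ordS3_cycle (i : 'I_3) : ordS (ordS (ordS i)) = i.
Proof. by apply: val_inj; case: i => [[|[|[|i]]] hi]. Qed.

Section ColoringOrder.
Variables (G : graph) (c : G -> 'I_3) (iota : G -> nat).
Hypotheses (tfG : triangle_free G) (cP : circular_coloring c).
Hypothesis iota_inj : injective iota.

(** The only order between different colours for which adjacency means that the later colour is the
    successor of the earlier one. *)
Let before x y :=
  c y = ordS (c x) /\ adj x y \/ c x = ordS (c y) /\ ~ adj x y.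

Let before_neq x y : before x y -> c x <> c y.
Proof.
by case=> -[e _] exy; [case: (@ordS3_neq (c x))|case: (@ordS3_neq (c y))];
  rewrite -e.
Qed.

Let before_total x y : c x <> c y -> before x y \/ before y x.
Proof.
move=> ncxy; have [//|e|e] := ord3_cases (c x) (c y).
  have [xy|xy] := pselect (adj x y); [left|right]; [by left|right].
  by split=> // /adj_sym.
have [xy|xy] := pselect (adj x y); [right; left|left; right] => //.
by split=> //; apply: adj_sym.
Qed.

Let ordS_asym x y : c y = ordS (c x) -> c x = ordS (c y) -> False.
Proof.
move=> e1 e2; case: (@ordS3_neq (c x)).
by rewrite -{2}(ordS3_cycle (c x)) -e1 -e2.
Qed.

Let before_asym x y : before x y -> ~ before y x.
Proof.
move=> [[e a]|[e a]] [[e' a']|[e' a']]; try exact: (ordS_asym e e').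
- by apply: a'; apply: adj_sym.
- by apply: a; apply: adj_sym.
Qed.

(** The three colour steps are each 1 or -1 and add up to 0 modulo 3, so they agree: all 1 gives a
    triangle, all -1 an independent triple with three colours. *)
Let before_acyclic x y z : before x y -> before y z -> ~ before z x.
Proof.
have [_ rainbow _] := cP.
move=> xy yz zx; move: (before_neq xy) (before_neq yz) (before_neq zx).
case: xy yz zx => [[e1 a1]|[e1 a1]] [[e2 a2]|[e2 a2]] [[e3 a3]|[e3 a3]];
  try congruence; move=> _ _ _.
- by apply: (tfG (x := x) (y := y) (z := z)); split=> //; apply: adj_sym.
- by apply: (rainbow z y x) => //; split; apply: nadjC.
Qed.

Let before_trans x y z : before x y -> before y z -> c x <> c z -> before x z.
Proof.
move=> xy yz /before_total[//|zx]; by case: (before_acyclic xy yz).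
Qed.

Let sep x y := exists2 a, before x a & before a y.

(** If the separating vertices a and b differ in colour, transitivity of [before] gives a
    contradiction; if they agree, x, y, a, b induce a 2K_2. *)
Let sep_asym x y : c x = c y -> sep x y -> ~ sep y x.
Proof.
move=> cxy [a xa ay] [b yb bx].
have [cab|ncab] := pselect (c a = c b); last first.
  have [ab|ba] := before_total ncab.
    apply: (before_asym xa); apply: (before_trans ab bx).
    by move/esym/(before_neq xa).
  apply: (before_asym yb); apply: (before_trans ba ay).
  by move/esym/(before_neq yb).
have [_ _ no2K2] := cP.
case: xa ay yb bx => [[e1 a1]|[e1 a1]] [[e2 a2]|[e2 a2]] [[e3 a3]|[e3 a3]]
  [[e4 a4]|[e4 a4]]; try by (case: (@ordS_asym x a); congruence).
- by apply: (no2K2 x y a b) => //; apply: nadjC.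
- by apply: (no2K2 x y b a) => //; apply: adj_sym.
Qed.

(** Within a colour class, vertices are ordered by what separates them. Unseparated ones compare
    alike with every other colour, so breaking ties by [iota] is consistent. *)
Let lt x y := c x <> c y /\ before x y \/
  c x = c y /\ (sep x y \/ ~ sep y x /\ (iota x < iota y)%N).

Lemma circular_coloring_order : exists lt : G -> G -> Prop,
  strict_total lt /\
  forall x y, lt x y -> (adj x y <-> c y = ordS (c x)).
Proof.
exists lt; split; last first.
  have [proper _ _] := cP.
  move=> x y [[ncxy [[e xy]|[e xy]]]|[cxy _]].
  - by [].
  - split=> // /ordS_asym; case=> //.
  - split; first by move/proper.
    by rewrite -cxy => /esym /ordS3_neq.
split.
- move=> x [[]//|[_ [[a xa /(before_asym xa)//]|[_]]]].
  by rewrite ltnn.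
(* Inside a class, [before] survives lowering its first argument or raising its second; otherwise
   the third vertex would separate the pair in the wrong order. *)
- have ltl x y z : c x = c y -> lt x y -> before y z -> before x z.
    move=> cxy ltxy yz; have ncz := before_neq yz.
    have [|//|zx] := @before_total x z; first by rewrite cxy.
    case: ltxy => [[]//|[_ [|[] nsep]]]; last by case: nsep; exists z.
    by move=> /(sep_asym cxy) []; exists z.
  have ltr x y z : c y = c z -> before x y -> lt y z -> before x z.
    move=> cyz xy ltyz; have ncz := before_neq xy.
    have [|//|zx] := @before_total x z; first by rewrite -cyz.
    case: ltyz => [[]//|[_ [|[] nsep]]]; last by case: nsep; exists x.
    by move=> /(sep_asym cyz) []; exists x.
  have lt_before x y : c x <> c y -> lt x y -> before x y by move=> ? [[]|[]].
  have before_lt x y : before x y -> lt x y.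
    by move=> xy; left; split=> //; apply: before_neq.
  move=> x y z xy yz.
  have [cxy|ncxy] := pselect (c x = c y);
    have [cyz|ncyz] := pselect (c y = c z).
  + right; split; first by rewrite cxy.
    case: (xy) => [[]//|[_ [[a xa ay]|[nyx ixy]]]].
      by left; exists a => //; apply: ltr yz.
    case: (yz) => [[]//|[_ [[a ya az]|[nzy iyz]]]].
      by left; exists a => //; apply: ltl xy ya.
    right; split; last exact: ltn_trans iyz.
    by move=> [a za ax]; apply: nzy; exists a => //; apply: ltr ax xy.
  + by apply: before_lt; apply: (ltl x y) => //; apply: lt_before.
  + by apply: before_lt; apply: (ltr x y) => //; apply: lt_before.
  + have xy' := lt_before _ _ ncxy xy; have yz' := lt_before _ _ ncyz yz.
    have [cxz|ncxz] := pselect (c x = c z).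
      by right; split=> //; left; exists y.
    by apply: before_lt; apply: before_trans xy' yz' ncxz.
- move=> x y xy; have [cxy|ncxy] := pselect (c x = c y); last first.
    have [?|?] := before_total ncxy; [left|right]; left; split=> //.
    by move/esym.
  have [?|nxy] := pselect (sep x y); first by left; right; split=> //; left.
  have [?|nyx] := pselect (sep y x); first by right; right; split=> //; left.
  case: (ltngtP (iota x) (iota y)) => [h|h|/iota_inj//].
  + by left; right; split=> //; right.
  + by right; right; split=> //; right.
Qed.

End ColoringOrder.

Local Open Scope ring_scope.

(** * Adjacency in C3 by arguments *)

Section Arg.
Variable R : realType.
Implicit Types z w : R[i].

Lemma unit_neq0 z : `|z| = 1 -> z != 0.
Proof. by move=> z1; rewrite -normr_eq0 z1 oner_eq0. Qed.

Lemma unit_polar z : `|z| = 1 -> z = Complex (cos (arg z)) (sin (arg z)).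
Proof. by move=> z1; rewrite {1}(arg_polar (unit_neq0 z1)) z1 mul1r. Qed.

Lemma norm_cos_sin (t : R) : `|Complex (cos t) (sin t)| = 1.
Proof. by rewrite normc_def /= cos2Dsin2 sqrtr1. Qed.

Lemma norm_arg_unit z : `|z| = 1 -> `|arg z| = acos (complex.Re z).
Proof.
move=> z1; rewrite /arg z1 divr1.
have h : -1 <= complex.Re z <= 1 by rewrite (unit_polar z1) /= cos_geN1 cos_le1.
by case: ifP => _; rewrite ?normrN ger0_norm ?acos_ge0.
Qed.

Lemma arg_cos_sin (t : R) : - pi < t < pi -> arg (Complex (cos t) (sin t)) = t.
Proof.
move=> /andP[lt_t t_lt]; rewrite /arg norm_cos_sin divr1 /=.
have [t0|t0] := leP 0 t.
  by rewrite sin_ge0_pi ?t0 ?ltW // cosK // in_itv /= t0 ltW.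
have st : sin t < 0.
  by rewrite -[t]opprK sinN oppr_lt0 sin_gt0_pi // oppr_gt0 t0 /= ltrNl.
by rewrite leNgt st /= cosKN ?opprK // !ltW.
Qed.

(** The real part of [z / w] is the cosine of the difference of arguments; [acos] absorbs the
    reduction modulo 2 pi. *)
Lemma norm_arg_div z w : `|z| = 1 -> `|w| = 1 ->
  `|arg (z / w)| = acos (cos (arg z - arg w)).
Proof.
move=> z1 w1; rewrite norm_arg_unit; last by rewrite normf_div z1 w1 divr1.
congr acos; rewrite cosB {1}(unit_polar z1) {1}(unit_polar w1).
rewrite invc_norm norm_cos_sin expr1n invr1 mul1r /=.
by rewrite mulrN opprK.
Qed.

Lemma acos_cos_gt (d : R) : `|d| < 2 * pi ->
  (2 / 3 * pi < acos (cos d)) = (2 / 3 * pi < `|d| < 4 / 3 * pi).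
Proof.
have pi0 := pi_gt0 R.
have -> : cos d = cos `|d| by case: (ler0P d) => _; rewrite ?cosN.
move: `|d| (normr_ge0 d) => {}d d0 d2pi.
have [dpi|dpi] := leP d pi.
  rewrite cosK ?in_itv /= ?d0 //; apply/idP/andP => [h|[]//]; split=> //; lra.
have -> : cos d = cos (2 * pi - d).
  by rewrite -[RHS]cosN opprB -[d in LHS](subrK (pi *+ 2)) cosD2pi mulr_natl.
rewrite cosK; last by rewrite in_itv /=; lra.
by apply/idP/andP => [h|[h1 h2]]; [split|]; lra.
Qed.

Lemma C3_adjE (z w : C3 R) : adj z w <->
  2 / 3 * pi < `|arg (sval z) - arg (sval w)| < 4 / 3 * pi.
Proof.
case: z w => [z [z1 zq]] [w [w1 wq]] /=.
have /andP[zl zr] := arg_bounds (unit_neq0 z1).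
have /andP[wl wr] := arg_bounds (unit_neq0 w1).
rewrite /C3_adj /= norm_arg_div // acos_cos_gt; last first.
  by rewrite ltr_norml; apply/andP; split; lra.
split=> [[]//|h]; split=> // -[e]; move: h; rewrite e subrr normr0.
by have := pi_gt0 R; lra.
Qed.

(** Differences of arguments are rational and pi is not, so no pair sits on an adjacency
    threshold. *)
Lemma C3_arg_dist_neq (z w : C3 R) (a : rat) : a != 0 ->
  `|arg (sval z) - arg (sval w)| != ratr a * pi.
Proof.
case: z w => [z [z1 [q zq]]] [w [w1 [r wr]]] /= a0.
rewrite zq wr -rmorphB -ratr_norm; apply/eqP => e.
apply: (@pi_irrationnal R); exists (`|q - r| / a) => //.
by rewrite rmorphM fmorphV /= e mulrAC divff ?mul1r // fmorph_eq0.
Qed.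

End Arg.

(** * The labelling of the complement of C3 *)

Lemma odd_abszD (m n : int) : odd `|m + n| = odd `|m| (+) odd `|n|.
Proof. by lia. Qed.

Section Winding.
Variables (R : realFieldType) (P : R).
Hypothesis P_gt0 : 0 < P.

(* On the circle of length 3 P, d is the signed length of the short arc from x
   to y and k counts its signed crossings of the cut point. *)
Definition short_arc (x y d : R) (k : int) : Prop :=
  y = x + d + 3 * P * k%:~R /\ `|d| < P.

Lemma short_arc_exists x y : `|x - y| < P \/ 2 * P < `|x - y| ->
  - (3 * P) < x - y < 3 * P ->
  exists d k, short_arc x y d k /\ odd `|k| = (2 * P < `|x - y|).
Proof.
move=> near bd.
have [far|nfar] := ltP (2 * P) `|x - y|; last first.
  exists (y - x), 0; rewrite /short_arc mulr0; split=> //; split; first lra.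
  by case: near; rewrite distrC // ltNge distrC nfar.
have [h|h] := leP 0 (x - y).
  move: far; rewrite ger0_norm // => far.
  exists (y - x + 3 * P), (-1); split=> //; split; first lra.
  by rewrite ltr_norml; apply/andP; split; lra.
move: far; rewrite ltr0_norm // => far.
exists (y - x - 3 * P), 1; split=> //; split; first lra.
by rewrite ltr_norml; apply/andP; split; lra.
Qed.

Lemma ltr_turns (m n : int) : (3 * P * m%:~R < 3 * P * n%:~R) = (m < n).
Proof. by rewrite ltr_pM2l ?ltr_int // mulr_gt0. Qed.

(** Arcs of opposite sign partly cancel, leaving x and z at circular distance less than P. *)
Lemma short_arc_same_sign x y z d1 d2 k1 k2 :
  short_arc x y d1 k1 -> short_arc y z d2 k2 ->
  P < `|x - z| < 2 * P -> 0 < d1 /\ 0 < d2 \/ d1 < 0 /\ d2 < 0.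
Proof.
move=> [-> d1P] [-> d2P].
set e := x - _; have -> : e = - (d1 + d2 + 3 * P * (k1 + k2)%:~R).
  by rewrite /e intrD; lra.
rewrite normrN => /andP[lo]; move: d1P d2P; rewrite !ltr_norml.
move=> /andP[l1 r1] /andP[l2 r2] /andP[l r].
(* Both the distance of x and z and the length of [d1 + d2] are below 2 P, and 4 P is less than 6
   P. *)
have k_lt2 : k1 + k2 < 2 by rewrite -ltr_turns; lra.
have k_gtN2 : -2 < k1 + k2 by rewrite -ltr_turns; lra.
have : [\/ k1 + k2 = -1, k1 + k2 = 0 | k1 + k2 = 1].
  have : (k1 + k2 == -1) || (k1 + k2 == 0) || (k1 + k2 == 1) by lia.
  by case/orP => [/orP[]|] /eqP; [apply: Or31|apply: Or32|apply: Or33].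
case=> kE; rewrite kE ?mulrN1z ?mulr0z ?mulr1z in lo l r.
all: have [h|h] := leP 0 (d1 + d2); [left|right];
  case: (ger0P (d1 + d2 + _)) lo => ? ?; split; lra.
Qed.

(** The total length is a nonzero multiple of 3 P below 6 P in absolute value: the closed walk winds
    exactly once. Four or five arcs of one sign, each shorter than P, meet these bounds. *)
Lemma winding_number_parity (d : R) (k : int) :
  d + 3 * P * k%:~R = 0 -> 0 < `|d| < 6 * P -> odd `|k|.
Proof.
move=> dk /andP[d_gt0]; rewrite ltr_norml => /andP[l r].
have k_lt2 : k < 2 by rewrite -ltr_turns; lra.
have k_gtN2 : -2 < k by rewrite -ltr_turns; lra.
have : k != 0.
  apply: contraTneq d_gt0 => k0; move: dk; rewrite k0 mulr0 addr0 => ->.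
  by rewrite normr0 ltxx.
lia.
Qed.

End Winding.

Section CircleSigning.
Variables (R : realFieldType) (P : R) (G : graph) (t : G -> R).
Hypothesis P_gt0 : 0 < P.
Hypothesis t_bounds : forall x, - (3 * P) < 2 * t x <= 3 * P.
Hypothesis adjE : forall x y, adj x y <-> P < `|t x - t y| < 2 * P.
Hypothesis t_generic :
  forall x y, `|t x - t y| != P /\ `|t x - t y| != 2 * P.

Let s x y := 2 * P < `|t x - t y|.

Let nadj_arc x y : ~ adj x y ->
  exists d k, short_arc P (t x) (t y) d k /\ odd `|k| = s x y.
Proof.
move=> xy; apply: short_arc_exists => //; last first.
  have /andP[? ?] := t_bounds x; have /andP[? ?] := t_bounds y.
  by apply/andP; split; lra.
have [neP ne2P] := t_generic x y.
case: (ltgtP `|t x - t y| P) neP => // [|h] _; first by left.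
case: (ltgtP `|t x - t y| (2 * P)) ne2P => // [h'|] _; last by right.
by case: xy; apply/adjE; rewrite h.
Qed.

Lemma circle_signing : exists s : G -> G -> bool, signing s.
Proof.
exists s; split.
- by move=> x y; rewrite /s distrC.
- move=> x y z /nadj_arc[d1 [k1 [[e1 a1] <-]]] /nadj_arc[d2 [k2 [[e2 a2] <-]]].
  move=> /nadj_arc[d3 [k3 [[e3 a3] <-]]].
  (* Three arcs shorter than P cannot close up around a circle of length 3 P, so the signed
     crossings cancel. *)
  have e : d1 + d2 + d3 + 3 * P * (k1 + k2 + k3)%:~R = 0.
    by rewrite !intrD; lra.
  move: a1 a2 a3; rewrite !ltr_norml => /andP[? ?] /andP[? ?] /andP[? ?].
  have lt1 : k1 + k2 + k3 < 1 by rewrite -(ltr_turns P_gt0); lra.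
  have gtN1 : -1 < k1 + k2 + k3 by rewrite -(ltr_turns P_gt0); lra.
  rewrite -!odd_abszD; lia.
- move=> x y z w /nadj_arc[d1 [k1 [a1 <-]]] /nadj_arc[d2 [k2 [a2 <-]]].
  move=> /nadj_arc[d3 [k3 [a3 <-]]] /nadj_arc[d4 [k4 [a4 <-]]].
  move=> /adjE xz /adjE yw.
  have s12 := short_arc_same_sign P_gt0 a1 a2 xz.
  have s23 := short_arc_same_sign P_gt0 a2 a3 yw.
  have s34 : 0 < d3 /\ 0 < d4 \/ d3 < 0 /\ d4 < 0.
    by apply: (short_arc_same_sign P_gt0 a3 a4); rewrite distrC.
  rewrite -!odd_abszD.
  case: a1 a2 a3 a4 => [e1 a1] [e2 a2] [e3 a3] [e4 a4].
  apply: (@winding_number_parity _ P P_gt0 (d1 + d2 + d3 + d4)).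
    by rewrite !intrD; lra.
  move: a1 a2 a3 a4; rewrite normr_gt0 !ltr_norml.
  move=> /andP[? ?] /andP[? ?] /andP[? ?] /andP[? ?].
  apply/andP; split; last by apply/andP; split; lra.
  apply/eqP; case: s12 => -[? ?]; case: s23 => -[? ?]; case: s34 => -[? ?]; lra.
- move=> x y z w u /nadj_arc[d1 [k1 [a1 <-]]] /nadj_arc[d2 [k2 [a2 <-]]].
  move=> /nadj_arc[d3 [k3 [a3 <-]]] /nadj_arc[d4 [k4 [a4 <-]]].
  move=> /nadj_arc[d5 [k5 [a5 <-]]].
  move=> /adjE xz /adjE yw /adjE zu /adjE wx _.
  have s12 := short_arc_same_sign P_gt0 a1 a2 xz.
  have s23 := short_arc_same_sign P_gt0 a2 a3 yw.
  have s34 := short_arc_same_sign P_gt0 a3 a4 zu.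
  have s45 := short_arc_same_sign P_gt0 a4 a5 wx.
  rewrite -!odd_abszD.
  case: a1 a2 a3 a4 a5 => [e1 a1] [e2 a2] [e3 a3] [e4 a4] [e5 a5].
  apply: (@winding_number_parity _ P P_gt0 (d1 + d2 + d3 + d4 + d5)).
    by rewrite !intrD; lra.
  move: a1 a2 a3 a4 a5; rewrite normr_gt0 !ltr_norml.
  move=> /andP[? ?] /andP[? ?] /andP[? ?] /andP[? ?] /andP[? ?].
  apply/andP; split; last by apply/andP; split; lra.
  apply/eqP; case: s12 => -[? ?]; case: s23 => -[? ?]; case: s34 => -[? ?];
    case: s45 => -[? ?]; lra.
Qed.

End CircleSigning.

Lemma C3_embedded_signing (R : realType) (G : graph) :
  embeds G (C3 R) -> exists s : G -> G -> bool, signing s.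
Proof.
move=> [f [_ fE]].
have pi0 := pi_gt0 R.
have eP : 2 * (2 / 3 * pi) = 4 / 3 * pi :> R by lra.
apply: (@circle_signing R (2 / 3 * pi) G (fun x => arg (sval (f x)))).
- by lra.
- move=> x; have /andP[? ?] := arg_bounds (unit_neq0 (proj1 (svalP (f x)))).
  by apply/andP; split; lra.
- by move=> x y; rewrite eP -C3_adjE fE.
- move=> x y; rewrite eP; split.
    have := @C3_arg_dist_neq R (f x) (f y) (2 / 3) isT.
    by rewrite rmorphM fmorphV !rmorph_nat.
  have := @C3_arg_dist_neq R (f x) (f y) (4 / 3) isT.
  by rewrite rmorphM fmorphV !rmorph_nat.
Qed.

(** * Embedding coloured linear orders into C3 *)

Section BinaryValue.
Variable R : realType.
Implicit Types (b : pred nat) (n i : nat).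

Definition weight n : R := 2^-1 ^+ n.+1.

Definition partial_value b n : R := \sum_(i < n | b i) weight i.

(** The real number with binary digits [b], as a supremum of bounded partial sums. It will place a
    countable linear order on the line. *)
Definition binary_value b : R := sup (range (partial_value b)).

Lemma weight_gt0 n : 0 < weight n.
Proof. by rewrite exprn_gt0 // invr_gt0. Qed.

Lemma partial_value_le b b' m n : (m <= n)%N -> (forall i, b i -> b' i) ->
  partial_value b m <= partial_value b' n.
Proof.
move=> mn bb'; rewrite /partial_value (big_ord_widen_cond n b weight mn).
rewrite big_mkcond [leRHS]big_mkcond; apply: ler_sum => i _.
have [/andP[/bb' ->]//|_] := ifP.
by case: ifP => // _; apply/ltW/weight_gt0.
Qed.

Lemma partial_value_le1 b n : partial_value b n <= 1.
Proof.
apply: (@le_trans _ _ (partial_value xpredT n)); first exact: partial_value_le.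
have -> : partial_value xpredT n = 1 - 2^-1 ^+ n.
  rewrite /partial_value; elim: n => [|n IH].
    by rewrite big_ord0 expr0 subrr.
  by rewrite big_ord_recr /= IH /weight exprS; lra.
by rewrite gerBl exprn_ge0 // invr_ge0.
Qed.

Lemma partial_value_gap b b' n i : (i < n)%N -> (forall j, b j -> b' j) ->
  ~~ b i -> b' i -> partial_value b n + weight i <= partial_value b' n.
Proof.
move=> lt_in bb' nbi b'i.
rewrite [leRHS]/partial_value (bigD1 (Ordinal lt_in)) //= [leLHS]addrC lerD2l.
rewrite /partial_value big_mkcond [leRHS]big_mkcond; apply: ler_sum => j _.
case: ifP => [bj|_]; last by case: ifP => // _; apply/ltW/weight_gt0.
rewrite bb' //= ifT //; apply: contraNneq nbi => ji.
by have /= <- := congr1 (@nat_of_ord n) ji.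
Qed.

Lemma partial_value_le_binary b n : partial_value b n <= binary_value b.
Proof.
apply: ub_le_sup; last by exists n.
by exists 1 => _ [m _ <-]; apply: partial_value_le1.
Qed.

Lemma binary_value_ge0 b : 0 <= binary_value b.
Proof.
by have := partial_value_le_binary b 0; rewrite /partial_value big_ord0.
Qed.

Lemma binary_value_le b (v : R) : (forall n, partial_value b n <= v) ->
  binary_value b <= v.
Proof.
move=> bv; apply: ge_sup; first by exists (partial_value b 0), 0%N.
by move=> _ [n _ <-].
Qed.

(** The gap of a full [weight] leaves an open interval in which a rational position can be
    chosen. *)
Lemma binary_value_gap b b' i : (forall j, b j -> b' j) -> ~~ b i -> b' i ->
  binary_value b + weight i <= binary_value b'.
Proof.
move=> bb' nbi b'i; rewrite -lerBrDr; apply: binary_value_le => n.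
(* Summing up to [n + i.+1] includes the digit i even when n is small. *)
rewrite lerBrDr; apply: le_trans (partial_value_le_binary b' (n + i.+1)).
apply: le_trans (partial_value_gap _ bb' nbi b'i); last first.
  by rewrite addnS ltnS leq_addl.
by rewrite lerD2r partial_value_le // leq_addr.
Qed.

Lemma binary_value_le1 b : binary_value b <= 1.
Proof. by apply: binary_value_le => n; apply: partial_value_le1. Qed.

End BinaryValue.

Section OrderEmbedding.
Variables (R : realType) (G : graph) (c : G -> 'I_3) (lt : G -> G -> Prop).
Hypotheses (ltP : strict_total lt)
  (lt_adj : forall x y, lt x y -> (adj x y <-> c y = ordS (c x))).
Hypothesis countG : countable [set: G].

Let P : R := 2 / 3 * pi.

(** Centres, in units of P, of three arcs of length P that tile the circle; colour 2 sits at -1 to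
    keep arguments between -pi and pi. *)
Let sector (i : 'I_3) : R := nth 0 [:: 0; 1; -1] i.

(** Each x owns the interval from [v x] to [v x + weight R (iota x)], and these intervals follow the
    order. The rational is picked after scaling and shifting to the sector, because P is
    irrational. *)
Lemma rational_positions : exists t : G -> rat,
  (forall x, - (P / 2) < ratr (t x) - P * sector (c x) < P / 2) /\
  forall x y, lt x y ->
    ratr (t x) - P * sector (c x) < ratr (t y) - P * sector (c y).
Proof.
have P_gt0 : 0 < P by rewrite /P; have := pi_gt0 R; lra.
have [iota iota_inj'] := countable_injP _ countG.
have iota_inj : injective iota by move=> x y; apply: iota_inj'; rewrite inE.
have [irr trans _] := ltP.
pose below x n := `[< exists2 y, iota y = n & lt y x >].
pose v x : R := binary_value R (below x).
have not_below x : ~~ below x (iota x).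
  by apply/asboolPn => -[y /iota_inj ->]; apply: irr.
have v_gap x y : lt x y -> v x + weight R (iota x) <= v y.
  move=> xy; apply: binary_value_gap => //.
    move=> n /asboolP[z zn zx]; apply/asboolP; exists z => //.
    exact: trans zx xy.
  by apply/asboolP; exists x.
have v_top x : v x + weight R (iota x) <= 1.
  apply: le_trans (binary_value_le1 _ xpredT).
  exact: binary_value_gap.
have t_exists x : exists q : rat,
    P * (v x - 1 / 2) < ratr q - P * sector (c x) <
    P * (v x + weight R (iota x) - 1 / 2).
  have h : P * (v x - 1 / 2) + P * sector (c x) <
      P * (v x + weight R (iota x) - 1 / 2) + P * sector (c x).
    by rewrite ltrD2r ltr_pM2l // ltrD2r ltrDl weight_gt0.
  have [q] := rat_in_itvoo h; rewrite in_itv /= => /andP[h1 h2].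
  by exists q; rewrite ltrBrDr ltrBlDr h1 h2.
have [t tE] := choice t_exists.
exists t; split=> [x|x y xy].
  have /andP[h1 h2] := tE x; apply/andP; split.
    apply: le_lt_trans h1; have := binary_value_ge0 R (below x).
    by rewrite -/(v x) -(ler_pM2l P_gt0); lra.
  apply: (lt_le_trans h2); have := v_top x.
  by rewrite -(ler_pM2l P_gt0); lra.
have /andP[_ h1] := tE x; have /andP[h2 _] := tE y.
apply: (lt_trans h1); apply: le_lt_trans h2.
by rewrite ler_pM2l // lerD2r v_gap.
Qed.

Lemma order_embedding : embeds G (C3 R).
Proof.
have pi0 := pi_gt0 R.
have P_gt0 : 0 < P by rewrite /P; lra.
have [t [t_bounds t_lt]] := rational_positions.
pose th x : R := ratr (t x).
have sector_cases i : [\/ sector i = 0, sector i = 1 | sector i = -1].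
  by case: i => [[|[|[|i]]] hi] //; [apply: Or31|apply: Or32|apply: Or33].
have th_bounds x : - pi < th x < pi.
  have /andP[] := t_bounds x; rewrite -/(th x) /P.
  by case: (sector_cases (c x)) => -> ? ?; apply/andP; split; lra.
have argE x : arg (Complex (cos (th x)) (sin (th x))) = th x.
  exact: arg_cos_sin.
have vertexP x : `|Complex (cos (th x)) (sin (th x))| = 1 /\
    exists q : rat, arg (Complex (cos (th x)) (sin (th x))) = ratr q.
  by split; [apply: norm_cos_sin|exists (t x)].
pose f x : C3 R := exist _ _ (vertexP x).
have [irr _ total] := ltP.
have f_adj_lt x y : lt x y -> (adj x y <-> adj (f x) (f y)).
  move=> xy; rewrite C3_adjE /= !argE (lt_adj xy).
  have := t_lt _ _ xy; rewrite -!/(th _).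
  have /andP[] := t_bounds x; have /andP[] := t_bounds y; rewrite -!/(th _).
  rewrite distrC /P /sector.
  (* The folded positions differ by an amount strictly between 0 and P, to which the sectors add a
     multiple of P; the distance falls between P and 2 P exactly when the colour advances by one. *)
  case: (c x) (c y) => [[|[|[|i]]] hi] [[|[|[|j]]] hj] //= b1 b2 b3 b4 b5;
    case: (ger0P (th y - th x)) => ?;
    split=> [e|/andP[? ?]]; first [exact: val_inj | by move/(congr1 val): e
      | by apply/andP; split; lra | by exfalso; lra].
have f_adj x y : adj x y <-> adj (f x) (f y).
  have [->|/total[/f_adj_lt//|/f_adj_lt yx]] := pselect (x = y).
    by split=> /adj_irrefl.
  by rewrite adjC yx adjC.
exists f; split=> // x y /(congr1 (fun z : C3 R => arg (sval z))) /=.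
rewrite !argE => exy; apply: contrapT => /total nxy.
(* The sectors are disjoint, so equal arguments force equal colours and then equal folded
   positions. *)
have f_lt x' y' : th x' = th y' -> ~ lt x' y'.
  move=> e /t_lt; have /andP[] := t_bounds x'; have /andP[] := t_bounds y'.
  rewrite -!/(th _) e.
  by case: (sector_cases (c x')) => ->; case: (sector_cases (c y')) => -> *;
    lra.
by case: nxy; apply: f_lt.
Qed.

End OrderEmbedding.

Theorem theorem1p1 (R : realType) (G : graph) :
  countable [set: G] -> triangle_free G ->
  (embeds G (C3 R) <-> anti_even_signable (complement G)).
Proof.
move=> countG tfG; split.
  by move=> /C3_embedded_signing[s]; apply: signing_signable.
move=> /signable_signing[s sP].
have [c cP] := signing_circular_coloring tfG sP.
have [iota iota_in_inj] := countable_injP _ countG.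
have iota_inj : injective iota by move=> x y; apply: iota_in_inj; rewrite inE.
have [lt [ltP lt_adj]] := circular_coloring_order tfG cP iota_inj.
exact: (order_embedding R ltP lt_adj countG).
Qed.
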